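(* Let $(x_n)$ and $(x_n^* )$ be normalized weakly null sequences in a real Banach space $X$ and in $X^*$ respectively. Assume that for some $\epsilon>0$ we have $\inf_n|x_n^*(x_n)|\ge\epsilon$. Let $1\le\xi<\omega_1$. The following are equivalent: (1) For every $M\in[\mathbb N]$ there exists $L\in[M]$ such that $(x_n^*|_{X_M})_{n\in L}$ is an $\ell_1^{\xi}$ spreading model. (2) For every $M\in[\mathbb N]$ there exists $L\in[M]$ such that $(x_n)_{n\in L}$ is a $c_0^{\xi}$ spreading model.
   Context: $[M]$ is the set of infinite subsets of $M$; for $L=(l_i)$ (increasing) the sequence $(z_n)_{n\in L}$ means $(z_{l_i})_{i\in\mathbb N}$. $X_M$ denotes the closed linear span of $(x_n)_{n\in M}$, and $x^*|_{X_M}$ the restriction of $x^*$ to $X_M$. For each countable ordinal $\xi$ fix successor ordinals $(\beta_n(\xi)+1)_n$: equal to $\xi$ if $\xi$ is a successor, strictly increasing to $\xi$ if $\xi$ is a limit. Schreier families: $S_0=\{\{n\}:n\in\mathbb N\}\cup\{\emptyset\}$; $S_{\zeta+1}=\{\bigcup_{i=1}^nF_i:n\le\min F_1,\ F_1<\cdots<F_n,\ F_i\in S_\zeta\}\cup\{\emptyset\}$ ($F<G$ means $\max F<\min G$); for limit $\xi$, $S_\xi=\{F:F\in S_{\beta_n(\xi)+1}\text{ for some }n\le\min F\}$. A semi-normalized $(y_i)$ is an $\ell_1^\xi$ spreading model if there is $c>0$ with $\|\sum_{i\in F}a_iy_i\|\ge c\sum_{i\in F}|a_i|$ for all $F\in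 S_\xi$ and scalars. $(y_i)$ is a $c_0^\xi$ spreading model if there is $C>0$ with $\|\sum_{i\in F}a_iy_i\|\le C\max_{i\in F}|a_i|$ for all $F\in S_\xi$ and scalars. *)

(* Defs.v *)
From HB Require Import structures.
From mathcomp Require Import all_boot all_order all_algebra.
From mathcomp Require Import all_classical all_reals all_analysis.
Set Implicit Arguments. Unset Strict Implicit. Unset Printing Implicit Defensive.
Import Order.TTheory GRing.Theory Num.Theory.
Import numFieldNormedType.Exports.
Local Open Scope classical_set_scope.
Local Open Scope ring_scope.

Inductive cord : Type :=
| OZero : cord
| OSucc : cord -> cord
| OLim  : (nat -> cord) -> cord.

Inductive ole : cord -> cord -> Prop :=
| ole_zero b : ole OZero b
| ole_succ a b : olt a b -> ole (OSucc a) b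
| ole_lim f b : (forall n, ole (f n) b) -> ole (OLim f) b
with olt : cord -> cord -> Prop :=
| olt_succ a b : ole a b -> olt a (OSucc b)
| olt_lim a f n : olt a (f n) -> olt a (OLim f).

Fixpoint cord_valid (a : cord) : Prop :=
  match a with
  | OZero => True
  | OSucc b => cord_valid b
  | OLim f => (forall n, exists b, f n = OSucc b) /\
              (forall n, olt (f n) (f n.+1)) /\
              (forall n, cord_valid (f n))
  end.

Inductive csub : cord -> cord -> Prop :=
| csub_refl a : csub a a
| csub_succ a b : csub a b -> csub a (OSucc b)
| csub_lim a f n : csub a (f n) -> csub a (OLim f).

(* Coherence: the fundamental sequences are a function of the ordinal,
   i.e. two sub-notations denoting the same ordinal are identical. *)
Definition cord_coherent (xi : cord) : Prop :=
  forall a b, csub a xi -> csub b xi -> ole a b -> ole b a -> a = b.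

(* Finite subsets of N = {1,2,...} are represented by strictly increasing
   lists of positive naturals. *)
Fixpoint schreier (xi : cord) (F : seq nat) : Prop :=
  match xi with
  | OZero => F = [::] \/ exists n, (0 < n)%N /\ F = [:: n]
  | OSucc z =>
      F = [::] \/
      exists Fs : seq (seq nat),
        [/\ F = flatten Fs,
            Fs != [::],
            (forall G, G \in Fs -> G != [::] /\ schreier z G),
            sorted ltn (flatten Fs) &
            (size Fs <= head 0%N (head [::] Fs))%N]
  | OLim f =>
      F = [::] \/ exists k, (k.+1 <= head 0%N F)%N /\ schreier (f k) F
  end.

Section Banach.
Variables (R : realType) (X : normedModType R).

Definition is_clf (f : X -> R) : Prop :=
  (forall (a : R) (x y : X), f (a *: x + y) = a * f x + f y) /\ continuous f.

Definition dnorm (f : X -> R) : R :=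
  sup [set `|f x| | x in [set x : X | `|x| <= 1]].

Definition weakly_null (x : nat -> X) : Prop :=
  forall f, is_clf f -> (fun n => f (x n)) @ \oo --> (0 : R).

Definition is_bidual (Phi : (X -> R) -> R) : Prop :=
  (forall (a : R) (f g : X -> R), is_clf f -> is_clf g ->
     Phi (fun x => a * f x + g x) = a * Phi f + Phi g) /\
  exists C : R, forall f, is_clf f -> `|Phi f| <= C * dnorm f.

Definition weakly_null_dual (xs : nat -> X -> R) : Prop :=
  (forall n, is_clf (xs n)) /\
  forall Phi, is_bidual Phi -> (fun n => Phi (xs n)) @ \oo --> (0 : R).

Definition incr (m : nat -> nat) : Prop := forall i, (m i < m i.+1)%N.

(* L in [M]: both given by their increasing enumerations *)
Definition subseqN (l m : nat -> nat) : Prop :=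
  incr l /\ forall i, exists j, l i = m j.

Definition XM (x : nat -> X) (m : nat -> nat) : set X :=
  closure [set y | exists (s : seq nat) (c : nat -> R),
                     y = \sum_(k <- s) c k *: x (m k)].

Definition rnorm (x : nat -> X) (m : nat -> nat) (g : X -> R) : R :=
  sup [set `|g y| | y in [set y | XM x m y /\ `|y| <= 1]].

(* y : positions 1,2,... (y 0 is ignored); c_0^xi spreading model *)
Definition c0_SM (xi : cord) (y : nat -> X) : Prop :=
  (exists a b : R, 0 < a /\ forall i, (0 < i)%N -> a <= `|y i| <= b) /\
  exists C : R, 0 < C /\ forall (F : seq nat) (a : nat -> R), schreier xi F ->
    `|\sum_(i <- F) a i *: y i| <= C * \big[Num.max/0]_(i <- F) `|a i|.

Definition l1_SM_restr (xi : cord) (x : nat -> X) (m : nat -> nat)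
    (g : nat -> X -> R) : Prop :=
  (exists a b : R, 0 < a /\ forall i, (0 < i)%N -> a <= rnorm x m (g i) <= b) /\
  exists c : R, 0 < c /\ forall (F : seq nat) (a : nat -> R), schreier xi F ->
    c * \sum_(i <- F) `|a i| <= rnorm x m (fun z => \sum_(i <- F) a i * g i z).

End Banach.

(* Main.v *)
(** (2) => (1): along an almost biorthogonal subsequence, the vectors
    [sum_{i in F} s_i x_i] with suitable signs [s_i] have norm at most [C] and
    witness the lower l1-estimate for [sum_{i in F} a_i x_i^*].

    (1) => (2): an Elton-type thinning yields a subsequence [M] such that if some
    [f] in the dual ball carries mass [sum_{i in F} |f(x_i)| >= p^2] on a finite
    [F] beyond the p-th position of [M], then some [g] in the ball carries the
    same mass on [F] and has summably small values on [M \ F] beyond that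
    position.  Apply (1) to this [M] and test the l1-estimate with the
    coefficients [g(x_i) / x_i^*(x_i)]: on a vector [v] of [X_M], whose
    coordinates are bounded by [2|v|/eps], this combination of the [x_i^*] almost
    computes [g(v)], so its norm on [X_M] is only O(p).  Hence [c p^2 = O(p)],
    which fails for large [p], and [sum_{i in F} |f(x_i)| <= p^2 + p] for all
    Schreier sets [F] and all [f] in the ball; Hahn-Banach turns this into the
    c0-estimate.

    The thinning is an infinite Ramsey argument run inside an ultrafilter: a
    configuration is doomed if ultrafilter-many one-point extensions lead, after
    finitely many steps, to a finite set on which the prescribed mass is attained,
    but by no functional that is small at the new gap [n].  If almost all [n] were doomed, one functional would be
    large at arbitrarily many of them, and an ultralimit of such functionals
    would contradict weak nullity. *)
Require Import Defs.
From HB Require Import structures.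
From mathcomp Require Import all_boot all_order all_algebra.
From mathcomp Require Import all_classical all_reals all_analysis.
From mathcomp Require Import ring lra zify.
Import Order.TTheory GRing.Theory Num.Theory.
Import numFieldNormedType.Exports.
Local Open Scope classical_set_scope.
Local Open Scope ring_scope.

(** * Norming functionals *)

Section HahnBanach.
Variables (R : realType) (X : normedModType R).

(** Homogeneity is an inequality because that form passes to infima; scaling back by [a^-1] gives
    the reverse one. *)
Definition sublinear_le_norm (p : X -> R) : Prop :=
  [/\ forall u v, p (u + v) <= p u + p v,
      forall a u, 0 < a -> p (a *: u) <= a * p u &
      forall u, p u <= `|u|].

Lemma sublinear0 (p : X -> R) : sublinear_le_norm p -> p 0 = 0.
Proof.
case=> pD _ pn; apply/eqP; rewrite eq_le.
have := pn 0; rewrite normr0 => ->; have := pD 0 0; rewrite addr0; lra.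
Qed.

Lemma sublinear_ge (p : X -> R) u : sublinear_le_norm p -> - `|u| <= p u.
Proof.
move=> ps; have p0 := sublinear0 _ ps; case: ps => pD _ pn.
have := pD u (- u); rewrite subrr p0; have := pn (- u); rewrite normrN; lra.
Qed.

(** The third index [k] makes one statement serve both uses: for chains it is the index of the
    smaller functional, for translates the sum of the two parameters. The lower bound [- |u|] makes
    every infimum genuine. *)
Lemma sublinear_inf (I : Type) (D : set I) (p : I -> X -> R) :
  D !=set0 -> (forall i, D i -> forall u, - `|u| <= p i u) ->
  (forall i u, D i -> p i u <= `|u| \/ exists2 j, D j & p j u <= `|u|) ->
  (forall i j u v, D i -> D j ->
     exists2 k, D k & p k (u + v) <= p i u + p j v) ->
  (forall i a u, D i -> 0 < a -> exists2 j, D j & p j (a *: u) <= a * p i u) ->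
  sublinear_le_norm (fun u => inf [set p i u | i in D]).
Proof.
move=> [i0 Di0] lb pn pD pZ.
have lbd u : has_lbound [set p i u | i in D].
  by exists (- `|u|) => _ [i Di <-]; exact: lb.
have ne u : [set p i u | i in D] !=set0 by exists (p i0 u), i0.
split=> [u v|a u a0|u].
- rewrite -lerBlDr; apply: lb_le_inf => // _ [i Di <-].
  rewrite lerBlDr -lerBlDl; apply: lb_le_inf => // _ [j Dj <-].
  rewrite lerBlDl; have [k Dk le_k] := pD i j u v Di Dj.
  by apply: le_trans le_k; apply: ge_inf => //; exists k.
- rewrite -ler_pdivrMl//; apply: lb_le_inf => // _ [i Di <-].
  rewrite ler_pdivrMl//; have [k Dk le_k] := pZ i a u Di a0.
  by apply: le_trans le_k; apply: ge_inf => //; exists k.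
- have [le|[j Dj le]] := pn i0 u Di0; apply: le_trans le; apply: ge_inf => //.
    by exists i0.
  by exists j.
Qed.

(* A pointwise minimal sublinear functional is additive because it coincides
   with its own translate below. *)
Definition translate_below (p : X -> R) (v u : X) : R :=
  inf [set p (u + t *: v) - t * p v | t in [set t : R | 0 <= t]].

Lemma translate_below_lb (p : X -> R) v u t : sublinear_le_norm p -> 0 <= t ->
  - `|u| <= p (u + t *: v) - t * p v.
Proof.
move=> ps; have p0 := sublinear0 _ ps; have pge := sublinear_ge _ _ ps.
case: ps => pD pZ pn; rewrite le_eqVlt => /orP[/eqP<-|t0].
  by rewrite scale0r addr0 mul0r subr0.
have := pD (u + t *: v) (- u); rewrite addrAC subrr add0r.
have := pn (- u); rewrite normrN.
have := pZ t^-1 (t *: v); rewrite invr_gt0 => /(_ t0).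
rewrite scalerA mulVf ?gt_eqF// scale1r ler_pdivlMl//; lra.
Qed.

Lemma translate_below_sublinear (p : X -> R) v :
  sublinear_le_norm p -> sublinear_le_norm (translate_below p v).
Proof.
move=> ps; apply: sublinear_inf.
- by exists 0 => /=.
- by move=> t t0 u; exact: translate_below_lb.
- move=> t u t0; right; exists 0 => //=.
  by rewrite scale0r addr0 mul0r subr0; case: ps.
- move=> s t u w /= s0 t0; exists (s + t); first exact: addr_ge0.
  have -> : u + w + (s + t) *: v = (u + s *: v) + (w + t *: v).
    by rewrite scalerDl addrACA.
  case: ps => pD _ _; have := pD (u + s *: v) (w + t *: v); rewrite mulrDl; lra.
- move=> t a u /= t0 a0; exists (a * t); first exact: mulr_ge0 (ltW a0) t0.
  rewrite -scalerA -scalerDr -mulrA mulrBr lerB//.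
  by case: ps => _ pZ _; exact: pZ.
Qed.

Lemma translate_below_le (p : X -> R) v u t : sublinear_le_norm p -> 0 <= t ->
  translate_below p v u <= p (u + t *: v) - t * p v.
Proof.
move=> ps t0; apply: ge_inf; last by exists t.
by exists (- `|u|) => _ [s s0 <-]; exact: translate_below_lb.
Qed.

(** Zorn's lemma for the reversed pointwise order: a nonempty chain is bounded by its pointwise
    infimum, the empty one by [q]. *)
Lemma minimal_sublinear (q : X -> R) : sublinear_le_norm q ->
  exists p, [/\ sublinear_le_norm p, forall u, p u <= q u &
    forall p', sublinear_le_norm p' -> (forall u, p' u <= p u) -> p' = p].
Proof.
move=> qs.
pose T := {p : X -> R | sublinear_le_norm p /\ forall u, p u <= q u}.
pose rle (p p' : T) := `[< forall u, sval p' u <= sval p u >].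
have [||||p pmin] := @Zorn T rle.
- by move=> p; apply/asboolP.
- move=> p1 p2 p3 /asboolP h12 /asboolP h23; apply/asboolP => u.
  exact: le_trans (h23 u) (h12 u).
- move=> [p1 h1] [p2 h2] /asboolP/= h12 /asboolP/= h21.
  have e : p1 = p2 by apply/funext => u; apply/eqP; rewrite eq_le h12 h21.
  by subst p2; congr exist; exact: Prop_irrelevance.
- move=> A Atot; have [[p0 Ap0]|Ae] := pselect (A !=set0); last first.
    by exists (exist _ q (conj qs (fun u => lexx _))) => s As; case: Ae; exists s.
  pose g u := inf [set sval p u | p in A].
  have gs : sublinear_le_norm g.
    apply: (@sublinear_inf T A (fun p => sval p)).
    + by exists p0.
    + by move=> [p [ps pq]] _ u /=; exact: sublinear_ge.
    + by move=> [p [[pD pZ pn] pq]] u _ /=; left.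
    + move=> p p' u v Ap Ap'; case: (Atot _ _ Ap Ap') => /asboolP h.
        exists p' => //; have := h u; case: (svalP p') => -[pD _ _] _.
        by have := pD u v; lra.
      exists p => //; have := h v; case: (svalP p) => -[pD _ _] _.
      by have := pD u v; lra.
    + by move=> p a u Ap a0; exists p => //; case: (svalP p) => -[_ pZ _] _; exact: pZ.
  have gle p u : A p -> g u <= sval p u.
    move=> Ap; apply: ge_inf; last by exists p.
    exists (- `|u|) => _ [p' _ <-].
    by apply: sublinear_ge; case: (svalP p').
  have gq u : g u <= q u by apply: le_trans (gle p0 u Ap0) _; case: (svalP p0).
  by exists (exist _ g (conj gs gq)) => s As; apply/asboolP => u /=; exact: gle.
case: p pmin => p [ps pq] pmin; exists p; split=> // p' ps' p'p.
have p'q u : p' u <= q u by exact: le_trans (p'p u) (pq u).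
have e : rle (exist _ p (conj ps pq)) (exist _ p' (conj ps' p'q)) by apply/asboolP.
by case: (pmin _ e).
Qed.

Definition inball (f : X -> R) : Prop :=
  (forall (a : R) (u v : X), f (a *: u + v) = a * f u + f v) /\
  forall u, `|f u| <= `|u|.

(** Hahn-Banach by minimality: a minimal sublinear functional below the translate of the norm along
    [v] is linear, and the translate forces the value at [v]. *)
Lemma norming_functional (v : X) : exists2 f, inball f & f v = `|v|.
Proof.
have ns : sublinear_le_norm (fun u : X => `|u|).
  split=> // [u w|a u a0]; first exact: ler_normD.
  by rewrite normrZ gtr0_norm.
have [p [ps pq pmin]] := minimal_sublinear _ (translate_below_sublinear _ v ns).
have p0 := sublinear0 _ ps.
have pvN : p (- v) <= - `|v|.
  apply: le_trans (pq _) _; apply: le_trans (translate_below_le _ v _ 1 ns ler01) _.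
  by rewrite scale1r addNr normr0 mul1r sub0r.
have pD u w : p (u + w) = p u + p w.
  case: (ps) => pD _ _; apply/eqP; rewrite eq_le pD /=.
  (* With [t = 0] the translate lies below [p], so it equals [p]; with [t = 1] this yields the
     missing half of additivity. *)
  have e : translate_below p w = p.
    apply: pmin; first exact: translate_below_sublinear.
    move=> z; apply: le_trans (translate_below_le _ w _ 0 ps (lexx 0)) _.
    by rewrite scale0r addr0 mul0r subr0.
  have := translate_below_le _ w u 1 ps ler01; rewrite e scale1r mul1r; lra.
have pN u : p (- u) = - p u.
  by apply/eqP; rewrite -addr_eq0 -pD addNr p0.
have pZ0 (a : R) u : 0 < a -> p (a *: u) = a * p u.
  move=> a0; case: (ps) => _ pZ _; apply/eqP; rewrite eq_le pZ//=.
  by have := pZ a (- u) a0; rewrite scalerN !pN mulrN lerN2.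
have pZ (a : R) u : p (a *: u) = a * p u.
  have [a0|a0|<-] := ltgtP 0 a; [exact: pZ0| |by rewrite scale0r mul0r].
  have := pZ0 (- a) u; rewrite oppr_gt0 scaleNr pN mulNr => /(_ a0).
  exact: oppr_inj.
have pn u : `|p u| <= `|u|.
  by rewrite ler_norml sublinear_ge//=; case: ps.
exists p; first by split => // a u w; rewrite pD pZ.
apply/eqP; rewrite eq_le (le_trans (ler_norm _) (pn v))/=.
by move: pvN; rewrite pN lerN2.
Qed.

End HahnBanach.

(** * Thinning by an ultrafilter *)

Lemma filter_all_seq (T : eqType) (F : set_system nat) (I : seq T)
    (B : T -> set nat) : Filter F ->
  (forall i, i \in I -> F (B i)) -> F [set k | forall i, i \in I -> B i k].
Proof.
move=> FF; elim: I => [|i I IH] FB; first exact: filterE.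
have FI := IH (fun j jI => FB j (mem_behead (s := i :: I) jI)).
apply: filterS (filterI (FB i (mem_head _ _)) FI) => k [Bik BIk] j.
by rewrite inE => /predU1P[->//|]; exact: BIk.
Qed.

Lemma sum_map_iota (R : realType) (m : nat -> nat) (b : pred nat) k (h : nat -> R) :
  \sum_(i <- [seq m i | i <- iota 0 k & b i]) h i = \sum_(i < k | b i) h (m i).
Proof.
have -> : iota 0 k = index_iota 0 k by rewrite /index_iota subn0.
by rewrite big_map big_filter big_mkord.
Qed.

Section UltraLimit.
Variable U : set_system nat.
Hypotheses (UU : UltraFilter U) (Uoo : \oo `<=` U).

Let UP : ProperFilter U. Proof. exact: (@ultra_proper _ _ UU). Qed.
Let UF : Filter U. Proof. exact: filter_filter. Qed.

Lemma ultra_ge N : U [set k | (N <= k)%N].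
Proof. by apply: Uoo; exists N. Qed.

Lemma ultra_bounded_cvg {R : realType} (u : nat -> R) (C : R) :
  (forall j, `|u j| <= C) -> exists p : R, u @ U --> p.
Proof.
move=> uC; have uI : (u @ U) `[- C, C]%classic.
  by apply: (@filterE _ U) => j; rewrite /= in_itv/= -ler_norml.
have [p [_ clp]] := @segment_compact R (- C) C (u @ U) _ uI.
exists p => B Bp; rewrite /nbhs/=.
have [//|UnB] := in_ultra_setVsetC (u @^-1` B) UU.
by have [y [nB yB]] := clp _ _ (UnB : (u @ U) (~` B)) Bp.
Qed.

(** Weak-star compactness of the dual ball, in the form of pointwise limits along [U]. *)
Lemma ball_ultralimit {R : realType} {X : normedModType R} (f : nat -> X -> R) :
  (forall j, inball R X (f j)) ->
  exists2 g, inball R X g & forall v, (fun j => f j v) @ U --> g v.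
Proof.
move=> fb; have /choice[g gl] v : exists p : R, (fun j => f j v) @ U --> p.
  by apply: ultra_bounded_cvg => j; exact: (fb j).2.
exists g => //; split=> [a u v|u].
  have e : (fun j => f j (a *: u + v)) = fun j => a * f j u + f j v.
    by apply/funext => j; exact: (fb j).1.
  rewrite -(cvg_lim (@Rhausdorff R) (gl (a *: u + v))) e.
  apply: cvg_lim; first exact: Rhausdorff.
  by apply: cvgD => //; apply: cvgMr.
apply: (cvgr_to_le (cvg_norm (gl u))).
by apply: filterE => j; exact: (fb j).2.
Qed.

(** Diagonal choice: the set for the next term may depend on the list of all earlier terms, and it
    is cut down to numbers above them. *)
Lemma ultra_selection (B : seq nat -> set nat) : (forall l, U (B l)) ->
  exists2 m, incr m & forall j, B (mkseq m j) (m j).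
Proof.
move=> UB; have /choice[g gB] l :
    exists k, B l k /\ forall n, n \in l -> (n < k)%N.
  have := filter_ex (filterI (UB l) (filter_all_seq _ U l (fun n k => (n < k)%N) UF
    (fun n _ => ultra_ge n.+1))).
  by case=> k [Bk lk]; exists k.
pose pre := fix pre j := if j is i.+1 then rcons (pre i) (g (pre i)) else [::].
pose m j := g (pre j).
have preE j : pre j = mkseq m j.
  by elim: j => // j IH; rewrite mkseqS -IH.
exists m => [j|j]; last by rewrite -preE; exact: (gB _).1.
by apply: (gB (pre j.+1)).2; rewrite /= mem_rcons mem_head.
Qed.

(** * Doomed configurations and the one-step thinning condition *)

Section Thinning.
Variables (R : realType) (X : normedModType R) (x : nat -> X).
Hypothesis xw : forall f, inball R X f -> (fun n => f (x n)) @ U --> 0.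
Variable d : nat -> R.
Hypothesis d0 : forall r, 0 < d r.

(* [F] carries the mass of the functional and [G] lists the gaps, the r-th of
   which must be seen with size at most [d r]. *)
Definition witness (t : R) (F G : seq nat) (f : X -> R) : Prop :=
  [/\ inball R X f,
      forall r, (r < size G)%N -> `|f (x (nth 0%N G r))| <= d r &
      t <= \sum_(i <- F) `|f (x i)|].

Definition bad (t : R) (G : seq nat) (n : nat) (F : seq nat) : Prop :=
  (exists f, witness t F G f) /\ ~ exists f, witness t F (rcons G n) f.

(** A least fixed point rather than a bounded number of steps: different branches of extensions may
    reach a [bad] set at different depths, with no uniform bound. *)
Inductive doomed (t : R) (G : seq nat) (n : nat) (F : seq nat) : Prop :=
| doomed_now : bad t G n F -> doomed t G n F
| doomed_later A : U A -> (forall k, A k -> doomed t G n (rcons F k)) ->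
    doomed t G n F.

Lemma witness_rcons t F G f k : witness t F G f -> witness t (rcons F k) G f.
Proof.
case=> fb fG fF; split=> //; rewrite -cats1 big_cat big_seq1/=.
by apply: le_trans fF _; rewrite lerDl.
Qed.

(** Enlarging [F] only adds mass, so [f] stays a witness along every branch; at a [bad] leaf it must
    violate the bound at [n], or it would witness [rcons G n]. *)
Lemma doomed_large t G n F f :
  doomed t G n F -> witness t F G f -> d (size G) < `|f (x n)|.
Proof.
elim=> {}F.
  move=> [_ nE] [fb fG fF]; rewrite ltNge; apply/negP => le.
  apply: nE; exists f; split=> // r; rewrite size_rcons ltnS nth_rcons.
  by rewrite leq_eqVlt => /predU1P[->|rG]; [rewrite ltnn eqxx|rewrite rG; exact: fG].
move=> A UA _ IH wf; have [k Ak] := filter_ex UA.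
exact: IH Ak (witness_rcons _ _ _ _ _ wf).
Qed.

(** Follow the derivation for [n], choosing extensions that keep all of the finite list doomed,
    until some member is [bad]. Its witness is then large at every member by [doomed_large]. *)
Lemma doomed_common t G n F (I : seq nat) :
  doomed t G n F -> (forall i, i \in n :: I -> doomed t G i F) ->
  exists2 f, inball R X f & forall i, i \in n :: I -> d (size G) < `|f (x i)|.
Proof.
elim=> {}F.
  move=> [[f wf] _] HI; exists f; first by case: wf.
  by move=> i iI; exact: doomed_large (HI i iI) wf.
move=> A UA _ IH HI.
have [[i iI [[f wf] _]]|nb] := pselect (exists2 i, i \in n :: I & bad t G i F).
  exists f; first by case: wf.
  by move=> j jI; exact: doomed_large (HI j jI) wf.
have UI : U [set k | forall i, i \in n :: I -> doomed t G i (rcons F k)].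
  apply: filter_all_seq => i iI; case: (HI i iI) => [bi|A' UA' A'd].
    by case: nb; exists i.
  exact: filterS UA'.
have [k [Ak Ik]] := filter_ex (filterI UA UI).
exact: IH Ak Ik.
Qed.

Lemma ultra_not_doomed t G F : U [set n | ~ doomed t G n F].
Proof.
have [UA|//] := in_ultra_setVsetC [set n | doomed t G n F] UU.
exfalso; have [n0 An0] := filter_ex UA.
(* The doomed index [n0] starts the descent even when no doomed index lies below [N]. *)
have /choice[f fP] N : exists f, inball R X f /\
    forall n, (n < N)%N -> doomed t G n F -> d (size G) < `|f (x n)|.
  have [|f fb fI] := doomed_common t G n0 F
      [seq n <- iota 0 N | `[< doomed t G n F >]] An0.
    by move=> i; rewrite inE mem_filter => /predU1P[->//|/andP[/asboolP]].
  exists f; split=> // n nN dn; apply: fI.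
  rewrite inE mem_filter mem_iota/= nN andbT; apply/orP; right; exact/asboolP.
have [g gb gl] := ball_ultralimit f (fun j => (fP j).1).
have gA n : doomed t G n F -> d (size G) <= `|g (x n)|.
  move=> dn; apply: (cvgr_to_ge (cvg_norm (gl _))).
  by apply: filterS (ultra_ge n.+1) => j nj; apply/ltW/(fP j).2.
have Us : U [set n | `|g (x n)| < d (size G)].
  have /cvgr0_norm_lt := xw g gb; exact.
have [n [An]] := filter_ex (filterI UA Us).
by move=> /=; rewrite ltNge gA.
Qed.

Lemma ultra_doomed_step t G n F : ~ doomed t G n F ->
  U [set k | ~ doomed t G n (rcons F k)].
Proof.
move=> nd.
have [UA|//] := in_ultra_setVsetC [set k | doomed t G n (rcons F k)] UU.
by exfalso; apply: nd; exact: (doomed_later _ _ _ _ _ UA).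
Qed.

(* Adding [k] keeps every choice of carrier and gaps inside [l] undoomed, for
   each of the first [size l + 1] thresholds. *)
Definition thin_next (T : nat -> R) (l : seq nat) : set nat :=
  [set k | forall (p : 'I_(size l).+1) (a b : (size l).-tuple bool),
     ~ doomed (T p) (mask b l) k (mask a l) /\
     forall i : 'I_(size l), ~ doomed (T p) (mask b l) (nth 0%N l i) (mask a l) ->
       ~ doomed (T p) (mask b l) (nth 0%N l i) (rcons (mask a l) k)].

(** Coding sublists by boolean tuples makes the conditions range over finite types, so each can be
    checked separately along the filter. *)
Lemma ultra_thin_next T l : U (thin_next T l).
Proof.
do 3 (apply: filter_forall => ?); apply: filterI; first exact: ultra_not_doomed.
apply: filter_forall => i.
set D := doomed _ _ _ (mask _ _); have [nd|d'] := pselect (~ D).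
  by apply: filterS (ultra_doomed_step _ _ _ _ nd) => k.
by apply: filterE => k nd; case: d'.
Qed.

Lemma thin_nextP T l k p F G : thin_next T l k -> (p <= size l)%N ->
  subseq F l -> subseq G l ->
  ~ doomed (T p) G k F /\ forall n, n \in l -> ~ doomed (T p) G n F ->
     ~ doomed (T p) G n (rcons F k).
Proof.
move=> Hk; rewrite -ltnS => pl /subseqP[a /eqP sa ->] /subseqP[b /eqP sb ->].
have [H1 H2] := Hk (Ordinal pl) (Tuple sa) (Tuple sb); split=> // n nl.
have il : (index n l < size l)%N by rewrite index_mem.
by have := H2 (Ordinal il); rewrite /= nth_index.
Qed.

(** * Functionals obtained from a thinned sequence *)

Section Thinned.
Variables (T : nat -> R) (m : nat -> nat) (p : nat) (a : pred nat).
Hypothesis mthin : forall j, thin_next T (mkseq m j) (m j).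

Let mass k := [seq m i | i <- iota 0 k & a i].
(** Gaps start at position [p] because [thin_next] handles the threshold [T p] only once the prefix
    has length at least [p]. *)
Let gaps k := [seq m i | i <- iota 0 k & (p <= i)%N && ~~ a i].

Let sub_prefix (b : pred nat) k j : (k <= j)%N ->
  subseq [seq m i | i <- iota 0 k & b i] (mkseq m j).
Proof.
move=> kj; apply: map_subseq; apply: subseq_trans (filter_subseq _ _) _.
by rewrite -(subnKC kj) iotaD prefix_subseq.
Qed.

Let step (b : pred nat) k : [seq m i | i <- iota 0 k.+1 & b i] =
  if b k then rcons [seq m i | i <- iota 0 k & b i] (m k)
  else [seq m i | i <- iota 0 k & b i].
Proof.
rewrite -[k.+1]addn1 iotaD/= filter_cat map_cat/= add0n.
by case: (b k); rewrite /= ?cats0// cats1.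
Qed.

(** Choosing [m k] makes it an undoomed gap for the current carrier; each later carrier point
    preserves this by the second half of [thin_nextP]. *)
Lemma thinned_not_doomed k j : (p <= k < j)%N -> ~~ a k ->
  ~ doomed (T p) (gaps k) (m k) (mass j).
Proof.
move=> /andP[pk kj] nak; elim: j kj => // j IH; rewrite ltnS leq_eqVlt.
move=> /predU1P[<-|kj]; rewrite /mass step.
  rewrite (negPf nak).
  have [|||nd _] // := thin_nextP T (mkseq m k) (m k) p (mass k) (gaps k) (mthin k).
  - by rewrite size_mkseq.
  - exact: sub_prefix.
  - exact: sub_prefix.
case: ifP => _; last exact: IH.
have [|||_] := thin_nextP T (mkseq m j) (m j) p (mass j) (gaps k) (mthin j).
- by rewrite size_mkseq (leq_trans pk)// ltnW.
- exact: sub_prefix.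
- exact: sub_prefix (ltnW kj).
apply; last exact: IH.
by apply: map_f; rewrite mem_iota.
Qed.

Lemma mass_stable N k : (forall i, a i -> (i < N)%N) -> (N <= k)%N -> mass k = mass N.
Proof.
move=> aN Nk; rewrite /mass -(subnKC Nk) iotaD filter_cat map_cat add0n.
rewrite (_ : [seq i <- iota N _ | a i] = [::]) ?cats0//.
apply/eqP; rewrite -size_eq0 size_filter -leqn0 leqNgt -has_count.
apply/hasPn => i; rewrite mem_iota => /andP[Ni _].
by apply/negP => /aN; rewrite ltnNge Ni.
Qed.

(** Gaps are added one at a time: were no witness left after adding [m k], the configuration would
    be [bad], hence doomed. *)
Lemma thinned_witness N : (forall i, a i -> (i < N)%N) ->
  (exists2 f, inball R X f & T p <= \sum_(i < N | a i) `|f (x (m i))|) ->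
  forall k, exists f, witness (T p) (mass (maxn N k)) (gaps k) f.
Proof.
move=> aN [f0 f0b f0T].
have wit0 f : T p <= \sum_(i < N | a i) `|f (x (m i))| ->
    T p <= \sum_(i <- mass N) `|f (x i)|.
  by rewrite (sum_map_iota _ m a N (fun n => `|f (x n)|)).
elim=> [|k [f wf]].
  exists f0; rewrite (mass_stable _ _ aN) ?leq_maxl//.
  by split=> //; exact: wit0.
move: wf; rewrite !(mass_stable _ _ aN) ?leq_maxl// => wf.
rewrite /gaps step; case: ifP => [/andP[pk nak]|_]; last by exists f.
apply: contrapT => nE.
apply: (thinned_not_doomed k (maxn N k.+1)); rewrite ?pk ?leq_maxr//=.
by apply: doomed_now; rewrite (mass_stable _ _ aN) ?leq_maxl//; split=> //; exists f.
Qed.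

(** Take an ultralimit of the witnesses for longer and longer gap lists; each estimate involves
    finitely many positions and so survives the limit. *)
Lemma thinned_functional D N : (forall k, \sum_(r < k) d r <= D) ->
  (forall i, a i -> (i < N)%N) ->
  (exists2 f, inball R X f & T p <= \sum_(i < N | a i) `|f (x (m i))|) ->
  exists g, [/\ inball R X g, T p <= \sum_(i < N | a i) `|g (x (m i))| &
    forall k, \sum_(i < k | (p <= i)%N && ~~ a i) `|g (x (m i))| <= D].
Proof.
move=> dD aN Hf; have /choice[f fP] := thinned_witness _ aN Hf.
have [|g gb gl] := ball_ultralimit f; first by move=> j; case: (fP j).
have suml (b : pred nat) k : (fun j => \sum_(i < k | b i) `|f j (x (m i))|) @ U -->
    \sum_(i < k | b i) `|g (x (m i))|.
  by apply: cvg_big => [|i _]; [exact: add_continuous|exact: cvg_norm (gl _)].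
exists g; split=> // [|k].
  apply: (cvgr_to_ge (suml a N)); apply: filterE => j.
  rewrite -(sum_map_iota _ m a N (fun n => `|f j (x n)|)).
  have -> : [seq m i | i <- iota 0 N & a i] = mass (maxn N j).
    by rewrite (mass_stable _ _ aN) ?leq_maxl.
  by case: (fP j).
apply: (cvgr_to_le (suml (fun i => (p <= i)%N && ~~ a i) k)).
apply: filterS (ultra_ge k) => j kj; case: (fP j) => _ fG _.
apply: (@le_trans _ _ (\sum_(i <- gaps j) `|f j (x i)|)).
  rewrite -(sum_map_iota _ m (fun i => (p <= i)%N && ~~ a i) k
    (fun n => `|f j (x n)|)) /gaps -(subnKC kj) iotaD filter_cat map_cat big_cat/=.
  by rewrite lerDl sumr_ge0.
rewrite (big_nth 0%N) big_mkord; apply: le_trans (dD (size (gaps j))).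
by apply: ler_sum => r _; exact: fG.
Qed.

End Thinned.
End Thinning.
End UltraLimit.

(** * Functionals and spans *)

Section Functionals.
Variables (R : realType) (X : normedModType R).
Implicit Types (f : X -> R).

Definition is_lin f := forall (a : R) (u v : X), f (a *: u + v) = a * f u + f v.

Lemma lin0 f : is_lin f -> f 0 = 0.
Proof. by move=> fl; have := fl (-1) 0 0; rewrite scaler0 addr0; lra. Qed.

Lemma linZ f a u : is_lin f -> f (a *: u) = a * f u.
Proof. by move=> fl; rewrite -[a *: u]addr0 fl lin0// addr0. Qed.

Lemma linB f u v : is_lin f -> f (u - v) = f u - f v.
Proof. by move=> fl; rewrite addrC -scaleN1r fl mulN1r addrC. Qed.

Lemma lin_sum f (I : Type) (r : seq I) (P : pred I) (c : I -> R) (u : I -> X) :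
  is_lin f -> f (\sum_(i <- r | P i) c i *: u i) = \sum_(i <- r | P i) c i * f (u i).
Proof.
move=> fl; elim/big_rec2: _ => [|i y1 y2 _ <-]; first exact: lin0.
exact: fl.
Qed.

Lemma sum_is_lin (I : Type) (r : seq I) (P : pred I) (c : I -> R) (g : I -> X -> R) :
  (forall i, is_lin (g i)) -> is_lin (fun z => \sum_(i <- r | P i) c i * g i z).
Proof.
move=> gl a u v; rewrite mulr_sumr -big_split/=; apply: eq_bigr => i _.
by rewrite gl mulrDr mulrCA.
Qed.

Lemma bounded_is_clf f C : is_lin f -> (forall v, `|f v| <= C * `|v|) -> is_clf f.
Proof.
move=> fl fC; split=> // u; apply/cvgrPdist_lt => e e0.
have C0 : 0 < `|C| + 1 by rewrite ltr_wpDl.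
have d0 : 0 < e / (`|C| + 1) by rewrite divr_gt0.
have ud : \forall v \near u, `|u - v| < e / (`|C| + 1) by exact: cvgr_dist_lt cvg_id _ d0.
apply: filterS ud => v; rewrite -linB// ltr_pdivlMr// => h.
apply: le_lt_trans (fC _) _; apply: le_lt_trans h; rewrite mulrC ler_wpM2l//.
by apply: le_trans (ler_norm _) _; rewrite lerDl.
Qed.

Lemma inball_is_clf f : inball R X f -> is_clf f.
Proof. by case=> fl fb; apply: (bounded_is_clf _ 1) => // v; rewrite mul1r. Qed.

Lemma clf_bounded f : is_clf f -> has_ubound [set `|f x| | x in [set x : X | `|x| <= 1]].
Proof.
move=> [fl fc]; have f0 := lin0 _ fl.
have c0 : f v @[v --> 0] --> 0 by rewrite -[X in _ --> X]f0; exact: fc.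
have [d /= d0 fd] := nbhs_norm0P.1 (cvgr0_norm_lt _ c0 _ ltr01).
exists (d / 2)^-1 => _ [u u1 <-].
have d2 : 0 < d / 2 by rewrite divr_gt0.
rewrite -[(d / 2)^-1]mul1r ler_pdivlMr// mulrC -{1}(gtr0_norm d2) -normrM -linZ//.
apply/ltW/fd => /=; rewrite normrZ (gtr0_norm d2).
apply: (@le_lt_trans _ _ (d / 2)); last by lra.
by rewrite ler_piMr// ltW.
Qed.

Lemma clf_le_dnorm f v : is_clf f -> `|f v| <= dnorm f * `|v|.
Proof.
move=> fc; have [->|v0] := eqVneq v 0.
  by rewrite normr0 mulr0 (lin0 _ fc.1) normr0.
have nv : 0 < `|v| by rewrite normr_gt0.
rewrite -ler_pdivrMr//; apply: ub_le_sup; first exact: clf_bounded.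
exists (`|v|^-1 *: v) => /=.
  by rewrite normrZ normfV normr_id mulVf ?gt_eqF.
by rewrite (linZ _ _ _ fc.1) normrM normfV normr_id mulrC.
Qed.

Lemma dnorm1_inball f : is_clf f -> dnorm f = 1 -> inball R X f.
Proof.
by move=> fc f1; split=> [|v]; [exact: fc.1|rewrite -[leRHS]mul1r -f1 clf_le_dnorm].
Qed.

(** This turns weak nullity in the dual into pointwise convergence to 0. *)
Lemma evaluation_is_bidual (v : X) : is_bidual (fun f : X -> R => f v).
Proof. by split=> //; exists `|v| => f fc; rewrite mulrC clf_le_dnorm. Qed.

End Functionals.

(** * Finite sums and off-diagonal estimates *)

Section Sums.
Variable R : realType.

Lemma sum_initial_le (N p : nat) (P : pred nat) (h : nat -> R) : (forall k, h k <= 1) ->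
  \sum_(k < N | P k && (k < p)%N) h k <= p%:R.
Proof.
move=> h1; suff : \sum_(k < N | P k && (k < p)%N) h k <= (minn N p)%:R.
  by move=> /le_trans; apply; rewrite ler_nat geq_minr.
elim: N => [|N IH]; first by rewrite big_ord0.
rewrite big_mkcond big_ord_recr -big_mkcond/=.
have [Np|pN] := ltnP N p; last first.
  by rewrite andbF addr0; apply: le_trans IH _; rewrite ler_nat; lia.
have -> : minn N.+1 p = (minn N p).+1 by lia.
rewrite -natr1 lerD//; case: ifP => //.
Qed.

Lemma sum_uniq_seq (N : nat) (s : seq nat) (b : pred nat) (h : nat -> R) :
  uniq s -> (forall k, k \in s -> (k < N)%N) ->
  \sum_(k <- s | b k) h k = \sum_(k < N | (val k \in s) && b k) h k.
Proof.
move=> us sN; rewrite -(big_mkord (fun k => (k \in s) && b k) h) -big_filter_cond.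
apply: perm_big; apply: uniq_perm => // [|k].
  by rewrite filter_uniq// iota_uniq.
rewrite mem_filter mem_index_iota /=.
by have [/sN|//] := boolP (k \in s).
Qed.

Lemma offdiag_sum_le (a : nat -> nat -> R) (t : R) : 0 <= t ->
  (forall i j, (i < j)%N ->
     a i j <= t / (2 ^+ j.+2 * j.+1%:R) /\ a j i <= t / (2 ^+ j.+2 * j.+1%:R)) ->
  forall N, \sum_(i < N) \sum_(j < N | j != i :> nat) a i j <= t.
Proof.
move=> t0 ae N.
(* Passing from [N] to [N.+1] adds a row and a column of [N] entries each, in total at most
   [t * 2 ^- N.+1]. *)
suff : \sum_(i < N) \sum_(j < N | j != i :> nat) a i j <= t * (1 - 2 ^- N).
  have p0 : 0 <= (2 : R) ^- N by rewrite invr_ge0 exprn_ge0.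
  by move=> /le_trans; apply; rewrite ler_piMr// gerBl.
elim: N => [|N IH]; first by rewrite big_ord0 expr0 invr1 subrr mulr0.
rewrite big_ord_recr/=.
have -> : \sum_(j < N.+1 | j != N :> nat) a N j = \sum_(j < N) a N j.
  rewrite big_mkcond big_ord_recr/= eqxx addr0.
  by apply: eq_bigr => j _; rewrite ltn_eqF.
have -> : \sum_(i < N) \sum_(j < N.+1 | j != i :> nat) a i j =
    \sum_(i < N) \sum_(j < N | j != i :> nat) a i j + \sum_(i < N) a i N.
  rewrite -big_split/=; apply: eq_bigr => i _.
  rewrite big_mkcond big_ord_recr/= -big_mkcond/=.
  by rewrite gtn_eqF.
set e := t / (2 ^+ N.+2 * N.+1%:R).
have e0 : 0 <= e by rewrite divr_ge0// mulr_ge0// exprn_ge0.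
have s1 : \sum_(i < N) a i N <= N%:R * e.
  rewrite mulr_natl -[X in _ *+ X](card_ord N) -sumr_const.
  by apply: ler_sum => i _; case: (ae i N (ltn_ord i)).
have s2 : \sum_(j < N) a N j <= N%:R * e.
  rewrite mulr_natl -[X in _ *+ X](card_ord N) -sumr_const.
  by apply: ler_sum => i _; case: (ae i N (ltn_ord i)).
have s3 : 2 * (N%:R * e) <= t * 2 ^- N.+1.
  have -> : t * 2 ^- N.+1 = 2 * (N.+1%:R * e).
    rewrite /e !exprS -natr1; field.
    by rewrite nat1r pnatr_eq0/= expf_neq0// -[1 + 1]/2%:R pnatr_eq0.
  by rewrite ler_pM2l// ler_wpM2r// ler_nat.
have -> : t * (1 - 2 ^- N.+1) = t * (1 - 2 ^- N) + t * 2 ^- N.+1.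
  by rewrite !exprS; field; rewrite expf_neq0// -[1 + 1]/2%:R pnatr_eq0.
by rewrite -addrA lerD//; lra.
Qed.

End Sums.

(** * Closed spans and norms of restrictions *)

Section Span.
Variables (R : realType) (X : normedModType R).

(** Repeated indices are merged by adding coefficients, and zero padding makes the length at least
    [N0]. *)
Lemma sum_seq_ord (y : nat -> X) (s : seq nat) (c : nat -> R) (h : nat -> nat) N0 :
  exists2 N, (N0 <= N)%N &
    exists b : nat -> R, \sum_(i <- s) c i *: y (h i) = \sum_(k < N) b k *: y k.
Proof.
suff H N : (forall i, i \in s -> (h i < N)%N) ->
    exists b : nat -> R, \sum_(i <- s) c i *: y (h i) = \sum_(k < N) b k *: y k.
  exists (N0 + (\max_(i <- s) h i).+1)%N; first exact: leq_addr.
  apply: H => i si; apply: ltn_addl; rewrite ltnS.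
  exact: leq_bigmax_seq.
elim: s => [|i s IH] sN.
  by exists (fun=> 0); rewrite big_nil big1// => k _; rewrite scale0r.
have [b e] := IH (fun k ks => sN k (mem_behead (s := i :: s) ks)).
exists (fun k => (if k == h i then c i else 0) + b k).
rewrite big_cons e; under [RHS]eq_bigr do rewrite scalerDl.
rewrite big_split/=; congr (_ + _).
have hN := sN i (mem_head _ _).
rewrite (bigD1 (Ordinal hN))//= eqxx big1 ?addr0// => k.
by rewrite -val_eqE/= => /negPf->; rewrite scale0r.
Qed.

Lemma XM_sum (x : nat -> X) (m : nat -> nat) (s : seq nat) (c : nat -> R)
    (h : nat -> nat) :
  XM x m (\sum_(i <- s) c i *: x (m (h i))).
Proof.
apply: subset_closure; have [N _ [b ->]] := sum_seq_ord (fun k => x (m k)) s c h 0.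
exists (iota 0 N), b.
by rewrite -(big_mkord xpredT (fun k => b k *: x (m k))) /index_iota subn0.
Qed.

(** The inequality defines a closed set, so finite combinations suffice, and padding with zeros
    makes them as long as desired. *)
Lemma XM_bound (x : nat -> X) (m : nat -> nat) (f : X -> R) (C : R) N0 : is_clf f ->
  (forall N (b : nat -> R), (N0 <= N)%N ->
     `|f (\sum_(k < N) b k *: x (m k))| <= C * `|\sum_(k < N) b k *: x (m k)|) ->
  forall v, XM x m v -> `|f v| <= C * `|v|.
Proof.
move=> [fl fc] fC v xv.
pose A := [set u : X | 0 <= C * `|u| - `|f u|].
have cA : closed A.
  apply: (@closed_comp _ _ (fun u : X => C * `|u| - `|f u|) [set y | 0 <= y]).
    move=> u _; apply: cvgB; first by apply: cvgMr; exact: norm_continuous.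
    by apply: cvg_norm; exact: fc.
  exact: closed_ge.
have : A v.
  rewrite (closure_id A).1//; apply: closureS xv => _ [s [c ->]].
  have [N N0N [b ->]] := sum_seq_ord (fun k => x (m k)) s c id N0.
  by rewrite /A/= subr_ge0 fC.
by rewrite /A/= subr_ge0.
Qed.

Lemma rnorm_le (x : nat -> X) (m : nat -> nat) (f : X -> R) (C : R) : 0 <= C ->
  (forall v, XM x m v -> `|f v| <= C * `|v|) -> rnorm x m f <= C.
Proof.
move=> C0 fC; apply: ge_sup.
  exists `|f 0|, 0 => //; split; last by rewrite normr0.
  by have := XM_sum x m [::] (fun=> 0) id; rewrite big_nil.
move=> _ [v [xv v1] <-]; apply: le_trans (fC v xv) _.
by rewrite ler_piMr.
Qed.

Lemma le_rnorm (x : nat -> X) (m : nat -> nat) (f : X -> R) (v : X) :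
  is_clf f -> XM x m v -> `|v| <= 1 -> `|f v| <= rnorm x m f.
Proof.
move=> fc xv v1; apply: ub_le_sup; last by exists v.
have [M fM] := clf_bounded _ _ _ fc.
by exists M => _ [u [_ u1] <-]; apply: fM; exists u.
Qed.

End Span.

(** * Almost biorthogonal sequences *)

Lemma incr_ltn (m : nat -> nat) : incr m -> {homo m : i j / (i < j)%N}.
Proof. by move=> mi; apply: homo_ltn => // ? ? ?; exact: ltn_trans. Qed.

Lemma incr_inj (m : nat -> nat) : incr m -> injective m.
Proof.
move=> mi i j e; have [ij|ij|//] := ltngtP i j.
  by have := incr_ltn _ mi _ _ ij; rewrite e ltnn.
by have := incr_ltn _ mi _ _ ij; rewrite e ltnn.
Qed.

Lemma incr_ge (m : nat -> nat) i : incr m -> (i <= m i)%N.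
Proof. by move=> mi; elim: i => // i IH; exact: leq_ltn_trans IH (mi i). Qed.

Lemma sorted_pos (F : seq nat) : sorted ltn F -> (0 < head 0 F)%N ->
  forall i, i \in F -> (0 < i)%N.
Proof.
case: F => //= n F sF n0 i; rewrite inE => /predU1P[->//|iF].
by apply: ltn_trans n0 _; exact: (allP (order_path_min ltn_trans sF)).
Qed.

Lemma schreier_sorted xi (F : seq nat) : schreier xi F ->
  sorted ltn F /\ forall i, i \in F -> (0 < i)%N.
Proof.
elim: xi F => [|z _|f IH] F /=.
- by case=> [->//|[n [n0 ->]]]; split=> // i; rewrite inE => /eqP->.
- case=> [->//|[Fs [-> Fs0 FsP sF size_le]]]; split=> //; apply: sorted_pos => //.
  case: Fs Fs0 FsP size_le {sF} => //= G Fs _ FsP size_le.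
  have [] := FsP G (mem_head _ _); case: G size_le {FsP} => //= n G.
  by move=> size_le _ _; exact: leq_ltn_trans (leq0n _) size_le.
- by case=> [->//|[k [_ /IH]]].
Qed.

Section Biorthogonal.
Variables (R : realType) (X : normedModType R).
Variables (y : nat -> X) (ys : nat -> X -> R) (eps : R).
Hypotheses (eps0 : 0 < eps) (ysb : forall i, inball R X (ys i)).
Hypothesis diag : forall i, eps <= `|ys i (y i)|.
Hypothesis offdiag : forall N,
  \sum_(i < N) \sum_(j < N | j != i :> nat) `|ys i (y j)| <= eps / 2.

Lemma row_offdiag N i : (i < N)%N ->
  \sum_(j < N | j != i :> nat) `|ys i (y j)| <= eps / 2.
Proof.
move=> iN; apply: le_trans (offdiag N).
rewrite [leRHS](bigD1 (Ordinal iN))//= lerDl.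
by apply: sumr_ge0 => k _; exact: sumr_ge0.
Qed.

Lemma coordinate_split (b : nat -> R) N i : (i < N)%N ->
  ys i (\sum_(k < N) b k *: y k) =
  b i * ys i (y i) + \sum_(k < N | k != i :> nat) b k * ys i (y k).
Proof.
move=> iN; rewrite (lin_sum _ _ _ _ _ _ (fun k : 'I_N => b k))//; last exact: (ysb i).1.
by rewrite (bigD1 (Ordinal iN)).
Qed.

Lemma coordinate_bound (b : nat -> R) N i : (i < N)%N ->
  `|b i| <= 2 / eps * `|\sum_(k < N) b k *: y k|.
Proof.
move=> iN; set v := \sum_(k < N) _.
pose beta := \big[Num.max/0]_(k < N) `|b k|.
have bb (k : 'I_N) : `|b k| <= beta by exact: le_bigmax.
have beta0 : 0 <= beta by exact: le_trans (bb (Ordinal iN)).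
(* Bound the largest coefficient by applying its coordinate functional: the off-diagonal terms cost
   at most half of [eps * beta] and are absorbed. *)
have key : beta <= (`|v| + beta * (eps / 2)) / eps.
  apply: bigmax_le => [|k _].
    by rewrite divr_ge0 ?addr_ge0 ?mulr_ge0// ltW.
  rewrite ler_pdivlMr//; apply: (@le_trans _ _ (`|b k * ys k (y k)|)).
    by rewrite normrM ler_wpM2l.
  have -> : b k * ys k (y k) = ys k v - \sum_(j < N | j != k :> nat) b j * ys k (y j).
    by rewrite coordinate_split// addrK.
  apply: le_trans (ler_normB _ _) _; apply: lerD; first exact: (ysb k).2.
  apply: le_trans (ler_norm_sum _ _ _) _.
  apply: (@le_trans _ _ (\sum_(j < N | j != k :> nat) beta * `|ys k (y j)|)).
    by apply: ler_sum => j _; rewrite normrM ler_wpM2r.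
  by rewrite -mulr_sumr ler_wpM2l// row_offdiag.
apply: le_trans (bb (Ordinal iN)) _; move: key; rewrite ler_pdivlMr// => key.
rewrite mulrAC ler_pdivlMr//; lra.
Qed.

(** * The combination of coordinate functionals that imitates [g] *)

Section TestFunctional.
Variables (g : X -> R) (a : pred nat) (N0 p : nat) (D : R).
Hypotheses (gb : inball R X g) (y1 : forall i, `|y i| = 1).
Hypothesis aN0 : forall i, a i -> (i < N0)%N.
Hypothesis gaps : forall N,
  \sum_(i < N | (p <= i)%N && ~~ a i) `|g (y i)| <= D.

Let alpha i := g (y i) / ys i (y i).

Lemma g_le1 i : `|g (y i)| <= 1.
Proof. by rewrite -(y1 i); exact: gb.2. Qed.

Lemma diag_neq0 i : ys i (y i) != 0.
Proof. by rewrite -normr_gt0; exact: lt_le_trans (diag i). Qed.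

Lemma alpha_le i : `|alpha i| <= eps^-1.
Proof.
rewrite normrM normfV -[leRHS]mul1r ler_pM//; first exact: g_le1.
by rewrite lef_pV2// posrE (lt_le_trans eps0).
Qed.

Lemma alpha_ge i : `|g (y i)| <= `|alpha i|.
Proof.
rewrite normrM normfV ler_pdivlMr ?normr_gt0 ?diag_neq0//.
by rewrite ler_piMr// -(y1 i); exact: (ysb i).2.
Qed.

(** Since [alpha i * ys i (y i) = g (y i)], the diagonal part is [g v] minus the terms outside [a].
    The three summands of the constant bound [g v], those terms, and the off-diagonal error. *)
Lemma test_functional_span N (b : nat -> R) : (N0 <= N)%N ->
  `|\sum_(i < N0 | a i) alpha i * ys i (\sum_(k < N) b k *: y k)| <=
  (1 + 2 / eps * (D + p%:R) + eps^-1) * `|\sum_(k < N) b k *: y k|.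
Proof.
move=> N0N; set v := \sum_(k < N) b k *: y k.
pose B := 2 / eps * `|v|.
have B0 : 0 <= B by rewrite mulr_ge0// divr_ge0// ltW.
have bB (k : 'I_N) : `|b k| <= B by exact: coordinate_bound.
have -> : \sum_(i < N0 | a i) alpha i * ys i v =
    g v - \sum_(i < N | ~~ a i) b i * g (y i) +
    \sum_(i < N | a i) alpha i * \sum_(k < N | k != i :> nat) b k * ys i (y k).
  rewrite (big_ord_widen_cond N a (fun i => alpha i * ys i v))//.
  under eq_bigl => i do rewrite (andb_idr (aN0 i)).
  have -> : g v = \sum_(i < N) b i * g (y i).
    by rewrite /v (lin_sum _ _ _ _ _ _ (fun k : 'I_N => b k))//; exact: gb.1.
  rewrite [X in _ = X - _ + _](bigID (fun i : 'I_N => a i))/= addrK -big_split/=.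
  apply: eq_bigr => i _; rewrite coordinate_split// mulrDr; congr (_ + _).
  by rewrite /alpha mulrCA divfK ?diag_neq0.
(* [D] covers the positions from [p] on; each of the first [p] positions contributes at most 1. *)
have gapN : \sum_(i < N | ~~ a i) `|g (y i)| <= D + p%:R.
  rewrite (bigID (fun i : 'I_N => (p <= i)%N))/=; apply: lerD.
    by under eq_bigl do rewrite andbC; exact: gaps.
  under eq_bigl do rewrite -ltnNge.
  exact: (sum_initial_le _ N p (predC a) (fun i => `|g (y i)|) g_le1).
have s2 : `|\sum_(i < N | ~~ a i) b i * g (y i)| <= B * (D + p%:R).
  apply: le_trans (ler_norm_sum _ _ _) _; apply: le_trans (ler_wpM2l B0 gapN).
  by rewrite mulr_sumr; apply: ler_sum => i _; rewrite normrM ler_wpM2r.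
have s3 : `|\sum_(i < N | a i) alpha i * \sum_(k < N | k != i :> nat) b k * ys i (y k)|
    <= eps^-1 * (B * (eps / 2)).
  have e0 : 0 <= eps^-1 by rewrite invr_ge0 ltW.
  apply: le_trans (ler_norm_sum _ _ _) _.
  apply: (@le_trans _ _ (\sum_(i < N) eps^-1 *
      (B * \sum_(k < N | k != i :> nat) `|ys i (y k)|))).
    rewrite big_mkcond; apply: ler_sum => i _; case: ifP => _; last first.
      by rewrite !mulr_ge0// sumr_ge0.
    rewrite normrM ler_pM// ?alpha_le//.
    apply: le_trans (ler_norm_sum _ _ _) _; rewrite mulr_sumr.
    by apply: ler_sum => k _; rewrite normrM ler_wpM2r.
  by rewrite -!mulr_sumr !ler_wpM2l.
have s1 := gb.2 v.
apply: le_trans (ler_normD _ _) _.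
apply: le_trans (lerD (le_trans (ler_normB _ _) (lerD s1 s2)) s3) _.
rewrite le_eqVlt; apply/orP; left; apply/eqP; rewrite /B; field; exact: lt0r_neq0.
Qed.

End TestFunctional.
End Biorthogonal.

(** * The two implications *)

Lemma geometric_le1 (R : realType) k : \sum_(r < k) (2 : R) ^- r.+1 <= 1.
Proof.
have -> : \sum_(r < k) (2 : R) ^- r.+1 = 1 - 2 ^- k.
  elim: k => [|k IH]; first by rewrite big_ord0 expr0 invr1 subrr.
  by rewrite big_ord_recr/= IH !exprS; field; rewrite expf_neq0// -[1 + 1]/2%:R pnatr_eq0.
by rewrite gerBl invr_ge0 exprn_ge0.
Qed.

Lemma positions_inj (l m h : nat -> nat) i j : incr l -> (forall k, l k = m (h k)) ->
  (0 < i)%N -> (0 < j)%N -> h i.-1 = h j.-1 -> i = j.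
Proof.
move=> li lm i0 j0 e; have := incr_inj _ li i.-1 j.-1; rewrite !lm e.
by move=> /(_ erefl); case: i j i0 j0 {e} => [//|i] [//|j] _ _ /= ->.
Qed.

Lemma positions_uniq xi (F : seq nat) (l m h : nat -> nat) : schreier xi F ->
  incr l -> (forall i, l i = m (h i)) -> uniq [seq h i.-1 | i <- F].
Proof.
move=> /schreier_sorted[sF Fpos] li lm.
rewrite map_inj_in_uniq; first exact: sorted_uniq ltn_trans ltnn _ sF.
by move=> i j /Fpos i0 /Fpos j0; exact: positions_inj lm _ _.
Qed.

Section MainLemmas.
Variables (R : realType) (X : normedModType R).
Variables (x : nat -> X) (xs : nat -> X -> R) (eps : R).
Hypotheses (x1 : forall n, `|x n| = 1) (xw : weakly_null x).
Hypotheses (xs1 : forall n, dnorm (xs n) = 1) (xsw : weakly_null_dual xs).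
Hypotheses (eps0 : 0 < eps) (diag : forall n, eps <= `|xs n (x n)|).

Lemma xs_inball n : inball R X (xs n).
Proof. by apply: dnorm1_inball => //; case: xsw. Qed.

Lemma thin_subsequence (m0 : nat -> nat) (T d : nat -> R) (D : R) :
  incr m0 -> (forall r, 0 < d r) -> (forall k, \sum_(r < k) d r <= D) ->
  exists m, [/\ subseqN m m0,
    forall N, \sum_(i < N) \sum_(j < N | j != i :> nat) `|xs (m i) (x (m j))| <= eps / 2 &
    forall (p : nat) (a : pred nat) N, (forall i, a i -> (i < N)%N) ->
      (exists2 f, inball R X f & T p <= \sum_(i < N | a i) `|f (x (m i))|) ->
      exists g, [/\ inball R X g, T p <= \sum_(i < N | a i) `|g (x (m i))| &
        forall k, \sum_(i < k | (p <= i)%N && ~~ a i) `|g (x (m i))| <= D]].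
Proof.
move=> m0i d0 dD.
(* An ultrafilter refining the image of the tails under [m0] contains [range m0], and contains all
   tails because [m0 k >= k]. *)
have [U [UU mU]] := ultraFilterLemma (fmap_proper_filter m0 (_ : ProperFilter \oo)).
have Uoo : \oo `<=` U.
  move=> A [N _ NA]; apply: mU; exists N => // k /= Nk; apply: NA => /=.
  exact: leq_trans Nk (incr_ge _ _ m0i).
have Um0 : U (range m0) by apply: mU; exists 0%N => // k _; exists k.
have UF : Filter U by exact: filter_filter.
have xU f : inball R X f -> (fun n => f (x n)) @ U --> 0.
  by move=> fb; apply: cvg_trans (xw _ (inball_is_clf _ _ _ fb)); apply: cvg_app.
have xsU v : (fun n => xs n v) @ U --> 0.
  by apply: cvg_trans (xsw.2 _ (evaluation_is_bidual R X v)); apply: cvg_app.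
(* The rate required by [offdiag_sum_le] for a total of [eps / 2]. *)
pose e j : R := eps / 2 / (2 ^+ j.+2 * j.+1%:R).
have e0 j : 0 < e j by rewrite divr_gt0 ?divr_gt0// mulr_gt0 ?exprn_gt0.
pose B l : set nat := thin_next U R X x d T l `&` (range m0 `&`
  [set k | forall n, n \in l ->
     `|xs n (x k)| <= e (size l) /\ `|xs k (x n)| <= e (size l)]).
have UB l : U (B l).
  apply: filterI; first exact: ultra_thin_next.
  apply: filterI => //; apply: filter_all_seq => n _.
  apply: filterI.
    exact: cvgr0_norm_le (xU _ (xs_inball n)) _ (e0 _).
  exact: cvgr0_norm_le (xsU _) _ (e0 _).
have [m mi mB] := ultra_selection U UU Uoo B UB.
exists m; split.
- split=> // i; have [_ [[j _ <-] _]] := mB i; by exists j.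
- apply: (offdiag_sum_le R (fun i j => `|xs (m i) (x (m j))|)).
    by rewrite divr_ge0// ltW.
  move=> i j ij; have [_ [_ /(_ (m i))]] := mB j.
  by rewrite size_mkseq; apply; apply: map_f; rewrite mem_iota.
- move=> p a N aP; apply: (thinned_functional U UU Uoo R X x d T m p a).
  + by move=> j; case: (mB j).
  + exact: dD.
  + exact: aP.
Qed.

Lemma l1_of_c0 (xi : cord) :
  (forall m, incr m -> exists l, subseqN l m /\ c0_SM xi (fun i => x (l i.-1))) ->
  forall m, incr m -> exists l, subseqN l m /\
    l1_SM_restr xi x m (fun i => xs (l i.-1)).
Proof.
move=> H m mi.
have [|m1 [[m1i m1m] off _]] :=
  thin_subsequence m (fun=> 0) (fun r => 2 ^- r.+1) 1 mi _ (geometric_le1 R).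
  by move=> r; rewrite invr_gt0 exprn_gt0.
have [l [[li lm1] [_ [C [C0 HC]]]]] := H m1 m1i.
have [h hl] := choice lm1; have [q qm1] := choice m1m.
have lq i : l i = m (q (h i)) by rewrite hl qm1.
exists l; split; first by split=> // i; exists (q (h i)).
split.
  exists eps, 1; split=> // i _; apply/andP; split.
    apply: le_trans (diag (l i.-1)) _.
    apply: le_rnorm; [exact/inball_is_clf/xs_inball| |by rewrite x1].
    have := XM_sum R X x m [:: i.-1] (fun=> 1) (q \o h).
    by rewrite big_seq1 scale1r /= -lq.
  by apply: rnorm_le => // v _; rewrite mul1r; exact: (xs_inball _).2.
(* Diagonal terms give [eps], off-diagonal ones cost at most [eps / 2], and the test vector has norm
   at most [C]. *)
exists (eps / 2 / C); split; first by rewrite !divr_gt0.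
move=> F a sF; have us := positions_uniq _ _ _ _ _ sF li hl.
have [sortF Fpos] := schreier_sorted _ _ sF.
have uF : uniq F by exact: sorted_uniq ltn_trans ltnn _ sortF.
pose f z := \sum_(i <- F) a i * xs (l i.-1) z.
pose s i := Num.sg (a i) * Num.sg (xs (l i.-1) (x (l i.-1))).
pose v := \sum_(i <- F) s i *: x (l i.-1).
have s1 i : `|s i| <= 1.
  by rewrite normrM !normr_sg mulr_ile1// lern1 ?leq_b1.
have fl : is_lin R X f.
  by apply: (sum_is_lin R X _ _ _ a (fun i => xs (l i.-1))) => i; exact: (xs_inball _).1.
have fc : is_clf f.
  apply: (bounded_is_clf R X f (\sum_(i <- F) `|a i|)) => // z.
  apply: le_trans (ler_norm_sum _ _ _) _; rewrite mulr_suml.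
  apply: ler_sum => i _; rewrite normrM ler_wpM2l//; exact: (xs_inball _).2.
have vC : `|v| <= C.
  apply: le_trans (HC F s sF) _; rewrite ler_piMr ?(ltW C0)//.
  exact: bigmax_le.
(* Positions in [l] are moved injectively to positions in [m1], where the sum is part of a full
   off-diagonal row. *)
have row i : i \in F ->
    `|\sum_(j <- F | j != i) s j * xs (l i.-1) (x (l j.-1))| <= eps / 2.
  move=> iF; apply: le_trans (ler_norm_sum _ _ _) _.
  pose ps := [seq h j.-1 | j <- F]; pose N := (\max_(k <- ps) k).+1.
  have psN k : k \in ps -> (k < N)%N.
    by move=> kps; rewrite ltnS; exact: (leq_bigmax_seq (F := id)).
  pose w k := `|xs (m1 (h i.-1)) (x (m1 k))|.
  apply: (@le_trans _ _ (\sum_(k < N | k != h i.-1 :> nat) w k)); last first.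
    apply: (row_offdiag R X (fun k => x (m1 k)) (fun k => xs (m1 k)) eps off).
    by apply: psN; exact: (map_f (fun j => h j.-1)).
  apply: (@le_trans _ _ (\sum_(k <- ps | k != h i.-1) w k)); last first.
    rewrite (sum_uniq_seq R N ps (fun k => k != h i.-1) w)//.
    rewrite big_mkcond [leRHS]big_mkcond/=; apply: ler_sum => k _.
    by case: ifP => [/andP[_ ->]//|_]; case: ifP => // _; rewrite /w.
  rewrite big_map big_seq_cond [leRHS]big_seq_cond.
  rewrite [leRHS](eq_bigl (fun j => (j \in F) && (j != i))); last first.
    move=> j; have [jF|//] := boolP (j \in F); congr (~~ _).
    apply/eqP/eqP => [e|->//].
    exact: (positions_inj _ _ _ _ _ li hl (Fpos _ jF) (Fpos _ iF) e).
  apply: ler_sum => j _; rewrite normrM /w -!hl ler_piMl//.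
have fv : eps / 2 * \sum_(i <- F) `|a i| <= f v.
  rewrite mulr_sumr big_seq_cond [leRHS]big_seq_cond; apply: ler_sum => i /andP[iF _].
  rewrite /v (lin_sum R X _ _ F _ s); last exact: (xs_inball _).1.
  rewrite (bigD1_seq i)//= mulrDr.
  have -> : a i * (s i * xs (l i.-1) (x (l i.-1))) = `|a i| * `|xs (l i.-1) (x (l i.-1))|.
    by rewrite /s !normrEsg; ring.
  set r := \sum_(_ <- _ | _) _; have rle : `|r| <= eps / 2 by exact: row.
  have h1 : `|a i| * eps <= `|a i| * `|xs (l i.-1) (x (l i.-1))| by rewrite ler_wpM2l.
  have h2 : - (a i * r) <= `|a i| * (eps / 2).
    apply: le_trans (ler_norm _) _; rewrite normrN normrM ler_wpM2l//.
  lra.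
have h3 : C^-1 * f v <= rnorm x m f.
  rewrite -(linZ R X)//; apply: le_trans (ler_norm _) _; apply: le_rnorm => //.
    rewrite /v scaler_sumr; under eq_bigr do rewrite scalerA.
    under eq_bigr do rewrite lq.
    exact: (XM_sum R X x m F (fun i => C^-1 * s i) (fun i => q (h i.-1))).
  by rewrite normrZ normfV (gtr0_norm C0) ler_pdivrMl// mulr1.
apply: le_trans h3; rewrite mulrAC mulrC ler_pM2l ?invr_gt0//.
Qed.

Lemma c0_of_l1 (xi : cord) :
  (forall m, incr m -> exists l, subseqN l m /\
    l1_SM_restr xi x m (fun i => xs (l i.-1))) ->
  forall m, incr m -> exists l, subseqN l m /\ c0_SM xi (fun i => x (l i.-1)).
Proof.
move=> H m0 m0i.
have [|m [[mi mm0] off thin]] :=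
  thin_subsequence m0 (fun p => p%:R ^+ 2) (fun r => 2 ^- r.+1) 1 m0i _ (geometric_le1 R).
  by move=> r; rewrite invr_gt0 exprn_gt0.
(* The hypothesis is applied to the thinned [m] itself, so that the norms are taken on the span
   where coordinates are controlled. *)
have [l [[li lm] [_ [c [c0 Hc]]]]] := H m mi.
have [h hl] := choice lm; have [q qm0] := choice mm0.
exists l; split; first by split=> // i; exists (q (h i)); rewrite hl qm0.
split; first by exists 1, 1; split=> // i _; rewrite x1 lexx.
(* The constant of [test_functional_span] with [D = 1]; it is affine in [p], against the quadratic
   threshold. *)
pose K (p : nat) : R := 1 + 2 / eps * (1 + p%:R) + eps^-1.
have ei : 0 < eps^-1 by rewrite invr_gt0.
have K0 p : 0 <= K p by rewrite !addr_ge0// ?mulr_ge0 ?addr_ge0// ltW.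
have [p pK] : exists p : nat, K p < c * p%:R ^+ 2.
  (* For [p >= 1], [K p] is at most [(K 0 + 2 / eps) * p], so any such [p > S] works. *)
  pose S := (K 0%N + 2 / eps) / c.
  have S0 : 0 <= S by rewrite divr_ge0 ?(ltW c0)// addr_ge0// divr_ge0// ltW.
  exists (Num.bound S).+1; set n : R := _.+1%:R.
  have nS : K 0%N + 2 / eps < n * c.
    rewrite -ltr_pdivrMr//; apply: lt_trans (archi_boundP S0) _.
    by rewrite ltr_nat.
  have n1 : 1 <= n by rewrite ler1n.
  have n0 : 0 < n by exact: lt_le_trans n1.
  have -> : c * n ^+ 2 = n * c * n by ring.
  apply: le_lt_trans (_ : (K 0%N + 2 / eps) * n < _); last by rewrite ltr_pM2r.
  have -> : K (Num.bound S).+1 = K 0%N + 2 / eps * n by rewrite /K -/n; ring.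
  by have := ler_peMr (K0 0%N) n1; lra.
have mass_le F f : schreier xi F -> inball R X f ->
    \sum_(i <- F) `|f (x (l i.-1))| <= p%:R ^+ 2 + p%:R.
  move=> sF fb; have us := positions_uniq _ _ _ _ _ sF li hl.
  rewrite leNgt; apply/negP => big.
  pose s := [seq h i.-1 | i <- F]; pose N := (\max_(k <- s) k).+1.
  have sN k : k \in s -> (k < N)%N.
    by move=> ks; rewrite ltnS; exact: (leq_bigmax_seq (F := id)).
  (* Discarding positions below [p] loses mass at most [p], which leaves the [p ^ 2] needed to
     invoke the thinning. *)
  pose a k := (k \in s) && (p <= k)%N.
  have aN k : a k -> (k < N)%N by case/andP => /sN.
  have sumF (w : nat -> R) : \sum_(i <- F) (if (p <= h i.-1)%N then w (h i.-1) else 0) =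
      \sum_(k < N | a k) w k.
    by rewrite -(sum_uniq_seq R N s (fun k => (p <= k)%N) w)// big_map -big_mkcond.
  have [|g [gb gT gaps]] := thin p a N aN.
    exists f => //; move: big; pose w k := `|f (x (m k))|.
    have -> : \sum_(i <- F) `|f (x (l i.-1))| = \sum_(k <- s) w k.
      by rewrite big_map; apply: eq_bigr => i _; rewrite /w -hl.
    rewrite (sum_uniq_seq R N s xpredT w)//.
    rewrite (bigID (fun k : 'I_N => (p <= k)%N))/=.
    under eq_bigl do rewrite andbT.
    under [X in _ < _ + X]eq_bigl do rewrite andbT -ltnNge.
    have w1 k : w k <= 1 by rewrite -(x1 (m k)); exact: fb.2.
    have := sum_initial_le R N p (mem s) w w1.
    by move=> h1 h2; apply/ltW; move: h1 h2; rewrite /a; lra.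
  pose al k := g (x (m k)) / xs (m k) (x (m k)).
  (* Zero coefficients at the discarded positions keep the combination indexed by all of [F], a
     Schreier set to which the l1-estimate applies. *)
  pose a' i := if (p <= h i.-1)%N then al (h i.-1) else 0.
  pose Phi z := \sum_(k < N | a k) al k * xs (m k) z.
  have PhiE z : \sum_(i <- F) a' i * xs (l i.-1) z = Phi z.
    rewrite /Phi -(sumF (fun k => al k * xs (m k) z)); apply: eq_bigr => i _.
    by rewrite /a' hl; case: ifP => // _; rewrite mul0r.
  have Phil : is_lin R X Phi.
    apply: (sum_is_lin R X _ _ _ (fun k : 'I_N => al k) (fun k : 'I_N => xs (m k))) => k.
    exact: (xs_inball _).1.
  have Phic : is_clf Phi.
    apply: (bounded_is_clf R X Phi (\sum_(k < N | a k) `|al k|)) => // z.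
    apply: le_trans (ler_norm_sum _ _ _) _; rewrite mulr_suml.
    apply: ler_sum => i _; rewrite normrM ler_wpM2l//; exact: (xs_inball _).2.
  have up : rnorm x m Phi <= K p.
    apply: rnorm_le => // v; apply: (XM_bound R X x m Phi (K p) N Phic) => N' b NN'.
    apply: (test_functional_span R X (fun k => x (m k)) (fun k => xs (m k)) eps) => //.
    by move=> i; exact: xs_inball.
  have low : c * p%:R ^+ 2 <= rnorm x m Phi.
    rewrite -(_ : (fun z => \sum_(i <- F) a' i * xs (l i.-1) z) = Phi); last first.
      by apply/funext => z; exact: PhiE.
    apply: le_trans (Hc F a' sF); rewrite ler_pM2l//; apply: le_trans gT _.
    have -> : \sum_(i <- F) `|a' i| = \sum_(k < N | a k) `|al k|.
      rewrite -(sumF (fun k => `|al k|)); apply: eq_bigr => i _.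
      by rewrite /a'; case: ifP => // _; rewrite normr0.
    apply: ler_sum => k _.
    apply: (alpha_ge R X (fun k => x (m k)) (fun k => xs (m k)) eps) => //.
    by move=> i; exact: xs_inball.
  by have := le_trans low up; rewrite leNgt pK.
(* The extra 1 makes the constant visibly positive. *)
exists (p%:R ^+ 2 + p%:R + 1); split=> [|F a sF]; first by rewrite ltr_wpDl// addr_ge0.
have [f fb <-] := norming_functional R X (\sum_(i <- F) a i *: x (l i.-1)).
rewrite (lin_sum R X _ _ F _ a); last exact: fb.1.
apply: le_trans (ler_norm _) _; apply: le_trans (ler_norm_sum _ _ _) _.
set M := (X in _ <= _ * X).
have M0 : 0 <= M by exact: bigmax_ge_id.
apply: (@le_trans _ _ (\sum_(i <- F) M * `|f (x (l i.-1))|)).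
  rewrite big_seq_cond [leRHS]big_seq_cond; apply: ler_sum => i /andP[iF _].
  rewrite normrM ler_wpM2r// /M.
  exact: (@Order.TotalTheory.le_bigmax_seq _ _ _ _ _ i xpredT (fun i => `|a i|)).
rewrite -mulr_sumr mulrC ler_wpM2r//; apply: le_trans (mass_le F f sF fb) _.
by rewrite lerDl.
Qed.

End MainLemmas.

Theorem theorem3p9 (R : realType) (X : completeNormedModType R)
  (x : nat -> X) (xs : nat -> X -> R) (eps : R) (xi : cord) :
  (forall n, `|x n| = 1) -> weakly_null x ->
  (forall n, dnorm (xs n) = 1) -> weakly_null_dual xs ->
  0 < eps -> (forall n, eps <= `|xs n (x n)|) ->
  cord_valid xi -> cord_coherent xi -> olt OZero xi ->
  ((forall m, incr m -> exists l, subseqN l m /\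
       l1_SM_restr xi x m (fun i => xs (l i.-1)))
   <->
   (forall m, incr m -> exists l, subseqN l m /\
       c0_SM xi (fun i => x (l i.-1)))).
Proof.
move=> x1 xw xs1 xsw eps0 diag _ _ _; split.
  exact: (c0_of_l1 R X x xs eps).
exact: (l1_of_c0 R X x xs eps).
Qed.
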